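(* The families $\eta=(\eta_M\colon\mathbb{N}\to FM)_M$ and $\nabla=(\nabla_M\colon FM\otimes FM\to FM)_M$, indexed by commutative monoids $M$, are both natural transformations in $\mathsf{CMon}$; that is, for every monoid homomorphism $\psi\colon M\to N$ of commutative monoids, $F\psi\circ\eta_M=\eta_N$ and $F\psi\circ\nabla_M=\nabla_N\circ(F\psi\otimes F\psi)$.
   Context: $\mathsf{CMon}$ is the category of commutative monoids with the usual tensor product $\otimes$ (universal for maps that are additive and zero-preserving in each variable). For a commutative monoid $(M,+,0)$, let $F_0M$ be the set of formal expressions freely generated inductively by: $0$; $1$; $x_m$ for each $m\in M$; $(a+b)$ and $(ab)$ for $a,b\in F_0M$; $f(a)$ for $a\in F_0M$. Let $\sim$ be the smallest equivalence relation on $F_0M$ such that for all $a,b,c\in F_0M$ and $m,n\in M$: $((a+b)+c)\sim(a+(b+c))$; $(a+0)\sim a$; $(a+b)\sim(b+a)$; $((ab)c)\sim(a(bc))$; $(a1)\sim a$; $(ab)\sim(ba)$; $((a+b)c)\sim((ac)+(bc))$; $(0a)\sim 0$; $x_0\sim 0$; $(x_m+x_n)\sim x_{m+n}$; and $a\sim b$ implies $(a+c)\sim(b+c)$, $(ac)\sim(bc)$, $f(a)\sim f(b)$. Set $FM:=F_0M/\sim$, with $[a]$ the class of $a$; it is a commutative rig (commutative semiring with $0$ and $1$) with $[a]+[b]=[(a+b)]$, $[a][b]=[(ab)]$, zero $[0]$, unit $[1]$, and self-map $\mathbf{f}([a])=[f(a)]$; it is viewed as a commutative monoid under $+$. For a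 monoid homomorphism $\psi\colon M\to N$, $F\psi\colon FM\to FN$ is the unique rig homomorphism commuting with the self-maps $\mathbf{f}$ and satisfying $F\psi([x_m])=[x_{\psi(m)}]$ for all $m\in M$. $\eta_M\colon\mathbb{N}\to FM$ is defined by $\eta_M(k)=k[1]$, and $\nabla_M\colon FM\otimes FM\to FM$ is the unique monoid homomorphism with $\nabla_M([a]\otimes[b])=[a][b]$ for all $[a],[b]\in FM$. *)

(* Defs.v *)
From HB Require Import structures.
From mathcomp Require Import all_boot all_algebra generic_quotient.
From mathcomp Require Import boolp.
Set Implicit Arguments.
Unset Strict Implicit.
Unset Printing Implicit Defensive.
Import GRing.Theory.
Local Open Scope ring_scope.
Local Open Scope quotient_scope.

(* CMon is represented by nmodType and {additive _ -> _}.  The choice structure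
   carried by an nmodType exists classically on every type (gen_choiceMixin). *)

Inductive F0 (M : Type) : Type :=
| F0zero
| F0one
| F0var of M
| F0add of F0 M & F0 M
| F0mul of F0 M & F0 M
| F0app of F0 M.
Arguments F0zero {M}.
Arguments F0one {M}.

HB.instance Definition _ (M : Type) := gen_eqMixin (F0 M).
HB.instance Definition _ (M : Type) := gen_choiceMixin (F0 M).

Inductive F0eq (M : nmodType) : F0 M -> F0 M -> Prop :=
| F0eq_refl a : F0eq a a
| F0eq_sym a b : F0eq a b -> F0eq b a
| F0eq_trans a b c : F0eq a b -> F0eq b c -> F0eq a c
| F0eq_addA a b c : F0eq (F0add (F0add a b) c) (F0add a (F0add b c))
| F0eq_addr0 a : F0eq (F0add a F0zero) a
| F0eq_addC a b : F0eq (F0add a b) (F0add b a)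
| F0eq_mulA a b c : F0eq (F0mul (F0mul a b) c) (F0mul a (F0mul b c))
| F0eq_mulr1 a : F0eq (F0mul a F0one) a
| F0eq_mulC a b : F0eq (F0mul a b) (F0mul b a)
| F0eq_mulDl a b c :
    F0eq (F0mul (F0add a b) c) (F0add (F0mul a c) (F0mul b c))
| F0eq_mul0r a : F0eq (F0mul F0zero a) F0zero
| F0eq_var0 : F0eq (F0var 0) F0zero
| F0eq_varD m n : F0eq (F0add (F0var m) (F0var n)) (F0var (m + n))
| F0eq_congD a b c : F0eq a b -> F0eq (F0add a c) (F0add b c)
| F0eq_congM a b c : F0eq a b -> F0eq (F0mul a c) (F0mul b c)
| F0eq_congf a b : F0eq a b -> F0eq (F0app a) (F0app b).

Definition F0rel (M : nmodType) : rel (F0 M) := fun a b => `[< F0eq a b >].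

Lemma F0rel_equiv (M : nmodType) : equiv_class_of (@F0rel M).
Proof.
split=> [a|a b|b a c].
- exact/asboolP/F0eq_refl.
- by apply/asboolP/asboolP; apply: F0eq_sym.
- by move=> /asboolP ab /asboolP bc; apply/asboolP; apply: F0eq_trans ab bc.
Qed.

Canonical F0rel_equiv_rel (M : nmodType) := EquivRelPack (F0rel_equiv M).

Definition F (M : nmodType) : Type := {eq_quot @F0rel_equiv_rel M}.
HB.instance Definition _ (M : nmodType) := Choice.on (F M).
HB.instance Definition _ (M : nmodType) := EqQuotient.on (F M).

Definition Fclass (M : nmodType) (a : F0 M) : F M := \pi_(F M) a.

Section FRig.
Variable M : nmodType.
Implicit Types (a b : F0 M) (x y z : F M).

Lemma FclassP a b : Fclass a = Fclass b <-> F0eq a b.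
Proof.
split=> [/eqP|ab]; first by rewrite eqmodE => /asboolP.
by apply/eqP; rewrite eqmodE; apply/asboolP.
Qed.

Lemma Frepr_eq a : F0eq (repr (Fclass a)) a.
Proof. by apply/FclassP; rewrite /Fclass reprK. Qed.

Lemma Fclass_ind (P : F M -> Prop) : (forall a, P (Fclass a)) -> forall x, P x.
Proof. by move=> Pc x; rewrite -[x]reprK; apply: Pc. Qed.

Definition Fadd x y : F M := Fclass (F0add (repr x) (repr y)).
Definition Fmul x y : F M := Fclass (F0mul (repr x) (repr y)).
Definition Fself x : F M := Fclass (F0app (repr x)).
Definition Fgen (m : M) : F M := Fclass (F0var m).

Lemma FaddE a b : Fadd (Fclass a) (Fclass b) = Fclass (F0add a b).
Proof.
apply/FclassP; apply: F0eq_trans (F0eq_congD _ (Frepr_eq a)) _.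
apply: F0eq_trans (F0eq_addC _ _) _; apply: F0eq_trans _ (F0eq_addC _ _).
exact/F0eq_congD/Frepr_eq.
Qed.

Lemma FmulE a b : Fmul (Fclass a) (Fclass b) = Fclass (F0mul a b).
Proof.
apply/FclassP; apply: F0eq_trans (F0eq_congM _ (Frepr_eq a)) _.
apply: F0eq_trans (F0eq_mulC _ _) _; apply: F0eq_trans _ (F0eq_mulC _ _).
exact/F0eq_congM/Frepr_eq.
Qed.

Lemma FselfE a : Fself (Fclass a) = Fclass (F0app a).
Proof. by apply/FclassP/F0eq_congf/Frepr_eq. Qed.

Lemma FaddA : associative Fadd.
Proof.
elim/Fclass_ind=> a; elim/Fclass_ind=> b; elim/Fclass_ind=> c.
by rewrite !FaddE; apply/esym/FclassP/F0eq_addA.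
Qed.

Lemma FaddC : commutative Fadd.
Proof.
elim/Fclass_ind=> a; elim/Fclass_ind=> b.
by rewrite !FaddE; apply/FclassP/F0eq_addC.
Qed.

Lemma Fadd0 : left_id (Fclass F0zero) Fadd.
Proof.
by elim/Fclass_ind=> a; rewrite FaddC FaddE; apply/FclassP/F0eq_addr0.
Qed.

HB.instance Definition _ := GRing.isNmodule.Build (F M) FaddA FaddC Fadd0.

Lemma FmulA : associative Fmul.
Proof.
elim/Fclass_ind=> a; elim/Fclass_ind=> b; elim/Fclass_ind=> c.
by rewrite !FmulE; apply/esym/FclassP/F0eq_mulA.
Qed.

Lemma FmulC : commutative Fmul.
Proof.
elim/Fclass_ind=> a; elim/Fclass_ind=> b.
by rewrite !FmulE; apply/FclassP/F0eq_mulC.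
Qed.

Lemma Fmul1 : left_id (Fclass F0one) Fmul.
Proof.
by elim/Fclass_ind=> a; rewrite FmulC FmulE; apply/FclassP/F0eq_mulr1.
Qed.

Lemma FmulDl : left_distributive Fmul Fadd.
Proof.
elim/Fclass_ind=> a; elim/Fclass_ind=> b; elim/Fclass_ind=> c.
rewrite FaddE !FmulE FaddE.
exact/FclassP/F0eq_mulDl.
Qed.

Lemma Fmul0 : left_zero (Fclass F0zero) Fmul.
Proof.
by elim/Fclass_ind=> a; rewrite FmulE; apply/FclassP/F0eq_mul0r.
Qed.

HB.instance Definition _ := GRing.Nmodule_isComPzSemiRing.Build (F M)
  FmulA FmulC Fmul1 FmulDl Fmul0.

Lemma Fclass0 : Fclass F0zero = 0. Proof. by []. Qed.
Lemma Fclass1 : Fclass F0one = 1. Proof. by []. Qed.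
Lemma FclassD a b : Fclass (F0add a b) = Fclass a + Fclass b.
Proof. by rewrite -FaddE. Qed.
Lemma FclassM a b : Fclass (F0mul a b) = Fclass a * Fclass b.
Proof. by rewrite -FmulE. Qed.
Lemma Fclass_app a : Fclass (F0app a) = Fself (Fclass a).
Proof. by rewrite FselfE. Qed.

End FRig.

Section FFunctor.
Variables (M N : nmodType) (psi : {additive M -> N}).

Fixpoint F0map (a : F0 M) : F0 N :=
  match a with
  | F0zero => F0zero
  | F0one => F0one
  | F0var m => F0var (psi m)
  | F0add a b => F0add (F0map a) (F0map b)
  | F0mul a b => F0mul (F0map a) (F0map b)
  | F0app a => F0app (F0map a)
  end.

Lemma F0map_eq a b : F0eq a b -> F0eq (F0map a) (F0map b).
Proof.
elim=> {a b} /=; try by (move=> *; constructor).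
- by move=> a b c _ ab _ bc; apply: F0eq_trans ab bc.
- by rewrite raddf0; constructor.
- by move=> m n; rewrite raddfD; constructor.
Qed.

Definition Fmap_fun (x : F M) : F N := Fclass (F0map (repr x)).

Lemma Fmap_funE a : Fmap_fun (Fclass a) = Fclass (F0map a).
Proof. by apply/FclassP/F0map_eq/Frepr_eq. Qed.

Lemma Fmap_nmod_morphism : nmod_morphism Fmap_fun.
Proof.
split; first by rewrite -Fclass0 Fmap_funE.
elim/Fclass_ind=> a; elim/Fclass_ind=> b.
by rewrite -FclassD !Fmap_funE /= FclassD.
Qed.

Lemma Fmap_monoid_morphism : monoid_morphism Fmap_fun.
Proof.
split; first by rewrite -Fclass1 Fmap_funE.
elim/Fclass_ind=> a; elim/Fclass_ind=> b.
by rewrite -FclassM !Fmap_funE /= FclassM.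
Qed.

HB.instance Definition _ :=
  GRing.isNmodMorphism.Build (F M) (F N) Fmap_fun Fmap_nmod_morphism.
HB.instance Definition _ :=
  GRing.isMonoidMorphism.Build (F M) (F N) Fmap_fun Fmap_monoid_morphism.

Definition Fmap : {rmorphism F M -> F N} := Fmap_fun.

Lemma Fmap_self x : Fmap (Fself x) = Fself (Fmap x).
Proof.
elim/Fclass_ind: x => a.
by rewrite FselfE /Fmap /= !Fmap_funE FselfE.
Qed.

Lemma Fmap_gen m : Fmap (Fgen m) = Fgen (psi m).
Proof. by rewrite /Fmap /= Fmap_funE. Qed.

Lemma Fmap_unique (g : {rmorphism F M -> F N}) :
  (forall x, g (Fself x) = Fself (g x)) ->
  (forall m, g (Fgen m) = Fgen (psi m)) -> g = Fmap :> (F M -> F N).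
Proof.
move=> gf gx; apply/funext; elim/Fclass_ind; elim=> [||m|a IHa b IHb|a IHa b IHb|a IHa].
- by rewrite Fclass0 !rmorph0.
- by rewrite Fclass1 !rmorph1.
- by rewrite -/(Fgen m) gx Fmap_gen.
- by rewrite FclassD !rmorphD IHa IHb.
- by rewrite FclassM !rmorphM IHa IHb.
- by rewrite Fclass_app gf Fmap_self IHa.
Qed.

End FFunctor.

Lemma Fmap_id (M : nmodType) : Fmap (idfun : {additive M -> M}) = id :> (_ -> _).
Proof.
by apply/esym; apply: (@Fmap_unique _ _ idfun (idfun : {rmorphism F M -> F M})).
Qed.

Lemma Fmap_comp (M N P : nmodType)
    (phi : {additive N -> P}) (psi : {additive M -> N}) :
  Fmap (phi \o psi : {additive M -> P}) = Fmap phi \o Fmap psi :> (_ -> _).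
Proof.
apply/esym.
apply: (@Fmap_unique _ _ (phi \o psi)
          (Fmap phi \o Fmap psi : {rmorphism F M -> F P})) => [x|m] /=.
  by rewrite !Fmap_self.
by rewrite !Fmap_gen.
Qed.

Definition biadditive (M N P : nmodType) (h : M -> N -> P) : Prop :=
  (forall n, nmod_morphism (h^~ n)) /\ (forall m, nmod_morphism (h m)).

(* M (x) N is the monoid generated by symbols m (x) n, modulo the congruence
   making (m, n) |-> m (x) n biadditive. *)
Inductive T0 (M N : Type) : Type :=
| T0zero
| T0pure of M & N
| T0add of T0 M N & T0 M N.
Arguments T0zero {M N}.

HB.instance Definition _ (M N : Type) := gen_eqMixin (T0 M N).
HB.instance Definition _ (M N : Type) := gen_choiceMixin (T0 M N).

Inductive T0eq (M N : nmodType) : T0 M N -> T0 M N -> Prop :=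
| T0eq_refl s : T0eq s s
| T0eq_sym s t : T0eq s t -> T0eq t s
| T0eq_trans s t u : T0eq s t -> T0eq t u -> T0eq s u
| T0eq_addA s t u : T0eq (T0add (T0add s t) u) (T0add s (T0add t u))
| T0eq_addr0 s : T0eq (T0add s T0zero) s
| T0eq_addC s t : T0eq (T0add s t) (T0add t s)
| T0eq_pure0l n : T0eq (T0pure 0 n) T0zero
| T0eq_pure0r m : T0eq (T0pure m 0) T0zero
| T0eq_pureDl m m' n :
    T0eq (T0pure (m + m') n) (T0add (T0pure m n) (T0pure m' n))
| T0eq_pureDr m n n' :
    T0eq (T0pure m (n + n')) (T0add (T0pure m n) (T0pure m n'))
| T0eq_congD s t u : T0eq s t -> T0eq (T0add s u) (T0add t u).

Definition T0rel (M N : nmodType) : rel (T0 M N) := fun s t => `[< T0eq s t >].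

Lemma T0rel_equiv (M N : nmodType) : equiv_class_of (@T0rel M N).
Proof.
split=> [s|s t|t s u].
- exact/asboolP/T0eq_refl.
- by apply/asboolP/asboolP; apply: T0eq_sym.
- by move=> /asboolP st /asboolP tu; apply/asboolP; apply: T0eq_trans st tu.
Qed.

Canonical T0rel_equiv_rel (M N : nmodType) := EquivRelPack (T0rel_equiv M N).

Definition tensor (M N : nmodType) : Type := {eq_quot @T0rel_equiv_rel M N}.
HB.instance Definition _ (M N : nmodType) := Choice.on (tensor M N).
HB.instance Definition _ (M N : nmodType) := EqQuotient.on (tensor M N).

Definition Tclass (M N : nmodType) (s : T0 M N) : tensor M N :=
  \pi_(tensor M N) s.

Section Tensor.
Variables M N : nmodType.
Implicit Types (s t : T0 M N) (x y : tensor M N).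

Lemma TclassP s t : Tclass s = Tclass t <-> T0eq s t.
Proof.
split=> [/eqP|st]; first by rewrite eqmodE => /asboolP.
by apply/eqP; rewrite eqmodE; apply/asboolP.
Qed.

Lemma Trepr_eq s : T0eq (repr (Tclass s)) s.
Proof. by apply/TclassP; rewrite /Tclass reprK. Qed.

Lemma Tclass_ind (P : tensor M N -> Prop) :
  (forall s, P (Tclass s)) -> forall x, P x.
Proof. by move=> Pc x; rewrite -[x]reprK; apply: Pc. Qed.

Definition Tadd x y : tensor M N := Tclass (T0add (repr x) (repr y)).

Lemma TaddE s t : Tadd (Tclass s) (Tclass t) = Tclass (T0add s t).
Proof.
apply/TclassP; apply: T0eq_trans (T0eq_congD _ (Trepr_eq s)) _.
apply: T0eq_trans (T0eq_addC _ _) _; apply: T0eq_trans _ (T0eq_addC _ _).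
exact/T0eq_congD/Trepr_eq.
Qed.

Lemma TaddA : associative Tadd.
Proof.
elim/Tclass_ind=> s; elim/Tclass_ind=> t; elim/Tclass_ind=> u.
by rewrite !TaddE; apply/esym/TclassP/T0eq_addA.
Qed.

Lemma TaddC : commutative Tadd.
Proof.
elim/Tclass_ind=> s; elim/Tclass_ind=> t.
by rewrite !TaddE; apply/TclassP/T0eq_addC.
Qed.

Lemma Tadd0 : left_id (Tclass T0zero) Tadd.
Proof.
by elim/Tclass_ind=> s; rewrite TaddC TaddE; apply/TclassP/T0eq_addr0.
Qed.

HB.instance Definition _ := GRing.isNmodule.Build (tensor M N) TaddA TaddC Tadd0.

Definition pure (m : M) (n : N) : tensor M N := Tclass (T0pure m n).

Lemma Tclass0 : Tclass T0zero = 0. Proof. by []. Qed.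
Lemma TclassD s t : Tclass (T0add s t) = Tclass s + Tclass t.
Proof. by rewrite -TaddE. Qed.

Lemma pure_biadditive : biadditive pure.
Proof.
split=> [n|m]; split=> [|p q] /=; rewrite -?Tclass0 -?TclassD; apply/TclassP; by constructor.
Qed.

Lemma tensor_ind (P : tensor M N -> Prop) :
  P 0 -> (forall m n, P (pure m n)) -> (forall x y, P x -> P y -> P (x + y)) ->
  forall x, P x.
Proof.
move=> P0 Pp PD; elim/Tclass_ind; elim=> [|m n|s Ps t Pt] //.
  exact: Pp.
by rewrite TclassD; apply: PD.
Qed.

Section Lift.
Variables (P : nmodType) (h : M -> N -> P).

Fixpoint T0eval (s : T0 M N) : P :=
  match s with
  | T0zero => 0
  | T0pure m n => h m n
  | T0add s t => T0eval s + T0eval t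
  end.

Hypothesis h_biadd : biadditive h.

Lemma T0eval_eq s t : T0eq s t -> T0eval s = T0eval t.
Proof.
case: h_biadd => hl hr; elim=> {s t} /=.
- by [].
- by [].
- by move=> s t u _ -> _ ->.
- by move=> s t u; rewrite addrA.
- by move=> s; rewrite addr0.
- by move=> s t; rewrite addrC.
- by move=> n; apply: (hl n).1.
- by move=> m; apply: (hr m).1.
- by move=> m m' n; apply: (hl n).2.
- by move=> m n n'; apply: (hr m).2.
- by move=> s t u _ ->.
Qed.

Definition tensor_lift_fun (_ : biadditive h) x : P := T0eval (repr x).

Lemma tensor_lift_funE s : tensor_lift_fun h_biadd (Tclass s) = T0eval s.
Proof. exact/T0eval_eq/Trepr_eq. Qed.

Lemma tensor_lift_nmod_morphism : nmod_morphism (tensor_lift_fun h_biadd).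
Proof.
split; first by rewrite -Tclass0 tensor_lift_funE.
elim/Tclass_ind=> s; elim/Tclass_ind=> t.
by rewrite -TclassD !tensor_lift_funE.
Qed.

HB.instance Definition _ := GRing.isNmodMorphism.Build (tensor M N) P
  (tensor_lift_fun h_biadd) tensor_lift_nmod_morphism.

Definition tensor_lift : {additive tensor M N -> P} := tensor_lift_fun h_biadd.

Lemma tensor_liftE m n : tensor_lift (pure m n) = h m n.
Proof. by rewrite /tensor_lift /= tensor_lift_funE. Qed.

Lemma tensor_lift_unique (g : {additive tensor M N -> P}) :
  (forall m n, g (pure m n) = h m n) -> g = tensor_lift :> (tensor M N -> P).
Proof.
move=> gh; apply/funext; elim/tensor_ind => [|m n|x y gx gy].
- by rewrite !raddf0.
- by rewrite gh tensor_liftE.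
- by rewrite !raddfD gx gy.
Qed.

End Lift.
End Tensor.

Section TensorMap.
Variables (M N M' N' : nmodType).
Variables (f : {additive M -> M'}) (g : {additive N -> N'}).

Lemma tensor_map_biadditive : biadditive (fun m n => pure (f m) (g n)).
Proof.
have [pl pr] := pure_biadditive M' N'.
split=> [n|m]; split=> [|p q] /=; rewrite ?raddf0 ?raddfD.
- exact: (pl (g n)).1.
- exact: (pl (g n)).2.
- exact: (pr (f m)).1.
- exact: (pr (f m)).2.
Qed.

Definition tensor_map : {additive tensor M N -> tensor M' N'} :=
  tensor_lift tensor_map_biadditive.

End TensorMap.

Lemma tensor_map_id (M N : nmodType) :
  tensor_map (idfun : {additive M -> M}) (idfun : {additive N -> N}) = id
    :> (_ -> _).
Proof.
by apply/esym/(@tensor_lift_unique _ _ _ _ _ (idfun : {additive _ -> tensor M N})).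
Qed.

Lemma tensor_map_comp (M N M' N' M'' N'' : nmodType)
    (f' : {additive M' -> M''}) (f : {additive M -> M'})
    (g' : {additive N' -> N''}) (g : {additive N -> N'}) :
  tensor_map (f' \o f : {additive M -> M''}) (g' \o g : {additive N -> N''}) =
  tensor_map f' g' \o tensor_map f g :> (_ -> _).
Proof.
apply/esym/(@tensor_lift_unique _ _ _ _ _
  (tensor_map f' g' \o tensor_map f g : {additive _ -> _})) => m n /=.
by rewrite !tensor_liftE.
Qed.

Lemma eta_nmod_morphism (M : nmodType) :
  nmod_morphism (fun k : nat => (1 : F M) *+ k).
Proof. by split=> [|k l] /=; rewrite ?mulr0n ?mulrnDr. Qed.

Definition eta_fun (M : nmodType) (k : nat) : F M := 1 *+ k.
HB.instance Definition _ (M : nmodType) :=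
  GRing.isNmodMorphism.Build nat (F M) (@eta_fun M) (eta_nmod_morphism M).
Definition eta (M : nmodType) : {additive nat -> F M} := @eta_fun M.

Lemma Fmul_biadditive (M : nmodType) : biadditive (fun x y : F M => x * y).
Proof.
split=> [y|x]; split=> [|p q] /=.
- exact: mul0r.
- exact: mulrDl.
- exact: mulr0.
- exact: mulrDr.
Qed.

Definition nabla (M : nmodType) : {additive tensor (F M) (F M) -> F M} :=
  tensor_lift (Fmul_biadditive M).

(* Main.v *)
Require Import Defs.
From mathcomp Require Import boolp.
From mathcomp Require Import all_boot all_algebra.

(** Both squares commute because [Fmap psi] is a rig homomorphism: preserving
    sums and the unit gives the square for [eta], preserving products gives the
    one for [nabla].  For [nabla] only pure tensors have to be compared, since
    these generate the tensor product and both composites are additive. *)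

Theorem proposition5p2 (M N : nmodType) (psi : {additive M -> N}) :
  Fmap psi \o eta M = eta N :> (nat -> F N) /\
  Fmap psi \o nabla M = nabla N \o tensor_map (Fmap psi) (Fmap psi)
    :> (tensor (F M) (F M) -> F N).
Proof.
split; apply/funext.
  by move=> k; rewrite /= /eta_fun GRing.rmorphMn GRing.rmorph1.
elim/tensor_ind=> [|a b|s t IHs IHt].
- by rewrite !GRing.raddf0.
- by rewrite [LHS]/comp [RHS]/comp !tensor_liftE GRing.rmorphM.
- by rewrite !GRing.raddfD; congr GRing.add.
Qed.
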